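(* Let $\mathcal{H}$ be an inner product space of dimension at least two, let $n\ge 1$ be an integer, and let real coefficients $c_A$ ($A\subseteq\overline{n}$) be given. Consider the formal expression $\sum_{A\subseteq\overline{n}} c_A\|x_A\|^2$, and let $\sum_{B\subseteq\overline{n},\,1\le|B|\le 2} a_B\|x_B\|^2$ be the formal expression obtained from it by replacing, for every $A$ with $|A|>2$, the term $\|x_A\|^2$ by $$\sum_{B\subseteq A,\,|B|=2}\|x_B\|^2-(|A|-2)\sum_{i\in A}\|x_i\|^2$$ and collecting coefficients. Then the identity $\sum_{A\subseteq\overline{n}} c_A\|x_A\|^2=0$ holds for all $x_1,\dots,x_n\in\mathcal{H}$ if and only if both of the following conditions hold: (1) $a_B=0$ for all $B\subseteq\overline{n}$ with $|B|=2$; and (2) for each unit vector $u\in\mathcal{H}$ and each $1\le i\le n$, if $x_i=u$ and $x_j=0$ for all $j\neq i$, then for this choice of vectors $\sum_{A\subseteq\overline{n}} c_A\|x_A\|^2=0$.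
   Context: $\overline{n}=\{1,2,\dots,n\}$. For $A\subseteq\overline{n}$, $x_A=\sum_{i\in A}x_i$ (so $x_\emptyset=0$), and $|A|$ is the cardinality of $A$. Norms are those induced by the inner product. The empty set contributes nothing to the expression. Explicitly, collecting coefficients gives $a_B=\sum_{B\subseteq A\subseteq\overline{n}}c_A$ for $|B|=2$, and $a_{\{i\}}=c_{\{i\}}-\sum_{A\subseteq\overline{n},\,i\in A,\,|A|>2}(|A|-2)c_A$ for $i\in\overline{n}$. *)

(* Defs.v *)
From HB Require Import structures.
From mathcomp Require Import all_boot all_order all_algebra.
From mathcomp Require Import reals complex.

Set Implicit Arguments.
Unset Strict Implicit.
Unset Printing Implicit Defensive.

Import Order.TTheory GRing.Theory Num.Theory.
Local Open Scope ring_scope.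

(* An inner product space is an [lmodType] H over the reals or the complexes
   (of any, possibly infinite, dimension), with a positive definite Hermitian
   form [{dot H for conj}], linear in its first argument. *)
Inductive scalar_kind := RealScalars | ComplexScalars.

Definition scalars (R : realType) (k : scalar_kind) : numFieldType :=
  match k with
  | RealScalars => R
  | ComplexScalars => R[i]
  end.

Definition scalar_conj (R : realType) (k : scalar_kind) :
    scalars R k -> scalars R k :=
  match k return scalars R k -> scalars R k with
  | RealScalars => fun z : R => z
  | ComplexScalars => fun z : R[i] => conjc z
  end.

Definition scalar_re (R : realType) (k : scalar_kind) : scalars R k -> R :=
  match k return scalars R k -> R with
  | RealScalars => fun z : R => z
  | ComplexScalars => fun z : R[i] => complex.Re z
  end.

Notation inner_product H := {dot H for @scalar_conj _ _}.

(* [dot x x] is a nonnegative real element of the scalar field, so taking its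
   real part only changes its type. *)
Definition hnorm (R : realType) (k : scalar_kind) (H : lmodType (scalars R k))
    (dot : inner_product H) (x : H) : R :=
  Num.sqrt (scalar_re (dot x x)).

Definition dim_at_least (m : nat) (K : fieldType) (H : lmodType K) : Prop :=
  exists e : 'I_m -> H,
    forall a : 'I_m -> K, \sum_(i < m) a i *: e i = 0 -> forall i, a i = 0.
Arguments dim_at_least m {K} H.

(* The formal expression $\sum_A c_A \|x_A\|^2$ is the finite function
   $A \mapsto c_A$: a vector in the free R-module on the symbols $\|x_A\|^2$. *)
Notation formal_expr R n := {ffun {set 'I_n} -> (R : realType)^o}.

Definition symbol {R : realType} {n : nat} (A : {set 'I_n}) : formal_expr R n :=
  [ffun B => (B == A)%:R].

(* The empty set is dropped, since $\|x_\emptyset\|^2$ is zero. *)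
Definition replacement {R : realType} {n : nat} (A : {set 'I_n}) :
    formal_expr R n :=
  if (2 < #|A|)%N then
    \sum_(B : {set 'I_n} | (B \subset A) && (#|B| == 2%N)) symbol B
      - (#|A| - 2)%:R *: \sum_(i in A) symbol [set i]
  else if A == set0 then 0 else symbol A.

Definition collect {R : realType} {n : nat} (c : formal_expr R n) :
    formal_expr R n :=
  \sum_(A : {set 'I_n}) c A *: replacement A.

Definition expr_value (R : realType) (k : scalar_kind)
    (H : lmodType (scalars R k)) (dot : inner_product H) (n : nat)
    (c : formal_expr R n) (x : 'I_n -> H) : R :=
  \sum_(A : {set 'I_n}) c A * hnorm dot (\sum_(i in A) x i) ^+ 2.

Lemma collect_pair (R : realType) (n : nat) (c : formal_expr R n)
    (B : {set 'I_n}) :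
  #|B| = 2%N -> collect c B = \sum_(A : {set 'I_n} | B \subset A) c A.
Proof.
move=> B2; rewrite /collect sum_ffunE [RHS]big_mkcond /=; apply: eq_bigr => A _.
rewrite ffunE /replacement; case: ltnP => A2.
  rewrite !ffunE !sum_ffunE [X in _ - X]/GRing.scale /=.
  rewrite [X in _ * X]big1 => [|i _]; last first.
    by rewrite ffunE; case: eqP => // E; rewrite E cards1 in B2.
  rewrite mulr0 subr0; case: ifP => BA.
    rewrite (bigD1 B) ?BA ?B2 //= ffunE eqxx big1 ?addr0 ?[LHS]mulr1 //.
    by move=> C /andP[_ CB]; rewrite ffunE eq_sym (negPf CB).
  rewrite big1 ?[LHS]mulr0 // => C /andP[CA _].
  by rewrite ffunE; case: eqP => // E; rewrite E CA in BA.
have -> : (B \subset A) = (B == A).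
  apply/idP/eqP => [BA|-> //]; apply/eqP; rewrite eqEcard BA B2 //.
case: (eqVneq A set0) => [->|A0]; rewrite ffunE.
  by case: eqP => [E|_]; [rewrite E cards0 in B2 | exact: mulr0].
by case: eqP => _; [exact: mulr1 | exact: mulr0].
Qed.

Lemma collect_single (R : realType) (n : nat) (c : formal_expr R n)
    (i : 'I_n) :
  collect c [set i] =
    c [set i] - \sum_(A : {set 'I_n} | (i \in A) && (2 < #|A|)%N)
                   (#|A| - 2)%:R * c A.
Proof.
rewrite /collect sum_ffunE (bigD1 [set i]) //= -sumrN; congr (_ + _).
  rewrite ffunE /replacement cards1 /= -cards_eq0 cards1 /= ffunE eqxx.
  exact: mulr1.
rewrite big_mkcond [RHS]big_mkcond /=; apply: eq_bigr => A _.
case: (eqVneq A [set i]) => [->|Ai] /=; first by rewrite cards1 andbF.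
rewrite ffunE /replacement; case: ltnP => A2.
  rewrite !ffunE !sum_ffunE andbT big1 ?add0r => [|B /andP[_ /eqP B2]]; last first.
    by rewrite ffunE; case: eqP => // E; rewrite -E cards1 in B2.
  case: ifP => iA.
    rewrite (bigD1 i) //= ffunE eqxx big1 ?addr0 => [|j /andP[_ ji]].
      by rewrite /GRing.scale /= mulr1 mulrN mulrC.
    by rewrite ffunE (inj_eq set1_inj) eq_sym (negPf ji).
  rewrite big1 ?[X in - X]mulr0 ?oppr0 ?[LHS]mulr0 // => j jA.
  rewrite ffunE (inj_eq set1_inj).
  by case: eqP => // E; rewrite E jA in iA.
rewrite andbF; case: ifP => _; rewrite ffunE ?[_ *: _]mulr0 //.
by rewrite eq_sym (negPf Ai); exact: mulr0.
Qed.

(* Main.v *)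
Require Import Defs.
From HB Require Import structures.
From mathcomp Require Import all_boot all_order all_algebra.
From mathcomp Require Import reals complex.

Set Implicit Arguments.
Unset Strict Implicit.
Unset Printing Implicit Defensive.

Import Order.TTheory GRing.Theory Num.Theory.
Local Open Scope ring_scope.

(** The expression is a quadratic form in the vectors: expanding each squared
    norm by bilinearity of the real part [r] of the inner product, it equals
    the sum over all [i] and [j] of [m i j * r (x i) (x j)], where the Gram
    coefficient [m i j] is the sum of the [c A] over the [A] containing [i] and
    [j] ([expr_value_gram]).  Off the diagonal [m i j] is exactly the collected
    coefficient of the pair [{i, j}], so condition (1) says that the matrix [m]
    is diagonal.  Placing a unit vector at [i] and zero elsewhere evaluates the
    expression to [m i i], so condition (2) says that the diagonal vanishes,
    and the two conditions together make the form zero.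

    Conversely, placing the same unit vector at two indices [i] and [j]
    evaluates the expression to [m i i + 2 m i j + m j j]
    ([expr_value_unit_on]); an identity kills this sum and both diagonal terms,
    hence [m i j].  A unit vector exists because the space is not zero. *)

(** For [i = j] the set [[set i; j]] is the singleton of [i], so one formula
    covers the diagonal as well. *)
Definition gram_coef (R : realType) (n : nat) (c : formal_expr R n)
    (i j : 'I_n) : R :=
  \sum_(A : {set 'I_n} | [set i; j] \subset A) c A.

Lemma gram_coefC (R : realType) (n : nat) (c : formal_expr R n) (i j : 'I_n) :
  gram_coef c i j = gram_coef c j i.
Proof. by rewrite /gram_coef setUC. Qed.

Lemma gram_coef_collect (R : realType) (n : nat) (c : formal_expr R n)
    (i j : 'I_n) :
  i != j -> gram_coef c i j = collect c [set i; j].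
Proof. by move=> ij; rewrite collect_pair // cards2 ij. Qed.

Section Scalars.
Variables (R : realType) (k : scalar_kind).

Lemma scalar_reD (a b : scalars R k) :
  scalar_re (a + b) = scalar_re a + scalar_re b.
Proof. by case: k a b => [//|[? ?] [? ?]]. Qed.

Lemma scalar_re0 : scalar_re (0 : scalars R k) = 0.
Proof. by case: k. Qed.

Lemma scalar_re_gt0 (a : scalars R k) : 0 < a -> 0 < scalar_re a.
Proof. by case: k a => [//|[a b]]; rewrite ltcE => /andP[]. Qed.

Definition real_scalar (t : R) : scalars R k :=
  match k return scalars R k with
  | RealScalars => t
  | ComplexScalars => t%:C%C
  end.

Lemma scalar_conj_real (t : R) : scalar_conj (real_scalar t) = real_scalar t.
Proof. by rewrite /real_scalar; case: k => //=; rewrite oppr0. Qed.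

Lemma scalar_re_realM (t : R) (a : scalars R k) :
  scalar_re (real_scalar t * a) = t * scalar_re a.
Proof.
by rewrite /real_scalar; case: k a => [//|[a b]] /=; rewrite mul0r subr0.
Qed.

End Scalars.

Section InnerProduct.
Variables (R : realType) (k : scalar_kind) (H : lmodType (scalars R k)).
Variable dot : inner_product H.

Lemma re_dot_gt0 (x : H) : x != 0 -> 0 < scalar_re (dot x x).
Proof. by move=> x0; apply/scalar_re_gt0/neq0_dnorm_gt0. Qed.

Lemma hnorm_sqr (x : H) : hnorm dot x ^+ 2 = scalar_re (dot x x).
Proof.
rewrite /hnorm sqr_sqrtr //; case: (eqVneq x 0) => [->|/re_dot_gt0/ltW //].
by rewrite linear0l scalar_re0.
Qed.

Lemma exists_unit_vector (x : H) : x != 0 -> exists u : H, hnorm dot u = 1.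
Proof.
move=> /re_dot_gt0 x_gt0; set s := Num.sqrt (scalar_re (dot x x)).
have s_gt0 : 0 < s by rewrite sqrtr_gt0.
exists (real_scalar k s^-1 *: x); rewrite /hnorm.
rewrite linearZl_LR linearZr_LR /= scalar_conj_real !scalar_re_realM.
rewrite -(sqr_sqrtr (ltW x_gt0)) -/s expr2.
by rewrite mulKf ?mulVf ?gt_eqF // sqrtr1.
Qed.

Lemma hnorm_sum_sqr (I : finType) (A : {set I}) (x : I -> H) :
  hnorm dot (\sum_(i in A) x i) ^+ 2 =
  \sum_(i in A) \sum_(j in A) scalar_re (dot (x i) (x j)).
Proof.
pose re_sum := big_morph _ (@scalar_reD R k) (scalar_re0 R k).
rewrite hnorm_sqr linear_sumlz re_sum; apply: eq_bigr => i _.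
by rewrite linear_sumr re_sum.
Qed.

(** Expanding bilinearly, a product of the [i]-th and [j]-th vectors arises in
    exactly the squared norms whose index set contains both [i] and [j]. *)
Lemma expr_value_gram (n : nat) (c : formal_expr R n) (x : 'I_n -> H) :
  expr_value dot c x =
  \sum_i \sum_j gram_coef c i j * scalar_re (dot (x i) (x j)).
Proof.
under [RHS]eq_bigr => i _.
  under eq_bigr => j _ do rewrite /gram_coef mulr_suml big_mkcond /=.
  rewrite exchange_big /=; over.
rewrite exchange_big; apply: eq_bigr => A _.
rewrite hnorm_sum_sqr mulr_sumr big_mkcond; apply: eq_bigr => i _.
case: ifPn => iA; last first.
  by rewrite big1 // => j _; rewrite subUset sub1set (negPf iA).
rewrite mulr_sumr big_mkcond; apply: eq_bigr => j _.
by rewrite subUset !sub1set iA.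
Qed.

(** Evaluating at the indicator of [S] times a unit vector picks out the block
    of Gram coefficients on [S]; one- and two-element sets recover them all. *)
Lemma expr_value_unit_on (n : nat) (c : formal_expr R n) (S : {set 'I_n})
    (u : H) (x : 'I_n -> H) :
  hnorm dot u = 1 -> (forall i, i \in S -> x i = u) ->
  (forall i, i \notin S -> x i = 0) ->
  expr_value dot c x = \sum_(i in S) \sum_(j in S) gram_coef c i j.
Proof.
move=> u1 xS x0; rewrite expr_value_gram [RHS]big_mkcond.
apply: eq_bigr => i _; case: ifPn => iS; last first.
  by rewrite big1 // => j _; rewrite (x0 i) // linear0l scalar_re0 mulr0.
rewrite [RHS]big_mkcond; apply: eq_bigr => j _; case: ifPn => jS.
  by rewrite !xS // -hnorm_sqr u1 expr1n mulr1.
by rewrite (x0 j) // linear0r scalar_re0 mulr0.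
Qed.

End InnerProduct.

Theorem theorem2p3 (R : realType) (k : scalar_kind)
    (H : lmodType (scalars R k)) (dot : inner_product H)
    (dimH : dim_at_least 2 H) (n : nat) (n_ge1 : (1 <= n)%N)
    (c : formal_expr R n) :
  (forall x : 'I_n -> H, expr_value dot c x = 0) <->
  (forall B : {set 'I_n}, #|B| = 2%N -> collect c B = 0) /\
  (forall (u : H) (i : 'I_n) (x : 'I_n -> H),
     hnorm dot u = 1 -> x i = u -> (forall j, j != i -> x j = 0) ->
     expr_value dot c x = 0).
Proof.
have [u u1] : exists u : H, hnorm dot u = 1.
  have [e e_free] := dimH; apply: (@exists_unit_vector _ _ _ dot (e ord0)).
  apply/eqP => e0.
  have rel : \sum_(i < 2) (i == ord0)%:R *: e i = 0.
    rewrite (bigD1 ord0) //= e0 scaler0 add0r big1 // => i /negPf->.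
    by rewrite scale0r.
  by have /eqP := e_free _ rel ord0; rewrite eqxx oner_eq0.
pose x_on (S : {set 'I_n}) i := if i \in S then u else 0.
have x_in (S : {set _}) i : i \in S -> x_on S i = u by rewrite /x_on => ->.
have x_out (S : {set _}) i : i \notin S -> x_on S i = 0
  by rewrite /x_on => /negPf->.
have diag0 : (forall i, expr_value dot c (x_on [set i]) = 0) ->
    forall i, gram_coef c i i = 0.
  move=> E i; rewrite -(E i) (expr_value_unit_on _ u1 (x_in _) (x_out _)).
  by rewrite !big_set1.
split=> [E | [pairs0 singles0]].
  split=> [B /eqP/cards2P[i [j [ij ->]]] | *]; last exact: E.
  rewrite -gram_coef_collect //.
  have := E (x_on [set i; j]).
  rewrite (expr_value_unit_on _ u1 (x_in _) (x_out _)).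
  rewrite big_setU1 ?in_set1 //= big_set1 !big_setU1 ?in_set1 //=.
  rewrite !big_set1 !diag0 //.
  rewrite add0r addr0 (gram_coefC c j i) => /eqP.
  by rewrite -mulr2n mulrn_eq0 => /eqP.
move=> x; rewrite expr_value_gram big1 // => i _; rewrite big1 // => j _.
have [<-|ij] := eqVneq i j; last first.
  by rewrite gram_coef_collect // pairs0 ?cards2 ?ij // mul0r.
rewrite diag0 ?mul0r // => p.
apply: (singles0 u p) => // [|q qp]; first by rewrite x_in ?set11.
by rewrite x_out ?in_set1.
Qed.
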